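(* For any prime $p\equiv 1\pmod 4$, $$\left(\frac{\sqrt{S_{3+\frac{p-1}{2},2}(-1,p)}}{p}\right)=(-1)^{\left|\left\{0<r<\frac{p}{4}\,:\,\left(\frac{r}{p}\right)=-1\right\}\right|}\left(\frac{p}{4+(-1)^{\frac{p-1}{4}}}\right),$$ where $r$ ranges over integers.
   Context: For an odd prime $p$, let $\alpha_1,\ldots,\alpha_{(p-1)/2}$ be integers representing the distinct (nonzero) quadratic residues modulo $p$, and for $n\in\mathbb{N}$, $d\in\mathbb{Z}$ put $$S_{n,2}(d,p)=\det\left[(\alpha_i+d\,\alpha_j)^n\right]_{1\le i,j\le \frac{p-1}{2}}.$$ When $p\equiv 1\pmod 4$ and $n$ is odd, $S_{n,2}(-1,p)$ is the determinant of a skew-symmetric integer matrix of even order, hence the square of an integer, and $\sqrt{S_{n,2}(-1,p)}$ denotes its integer square root (the sign is immaterial inside the Legendre symbol since $p\equiv 1\pmod 4$). $\left(\frac{\cdot}{p}\right)$ is the Legendre symbol, and $\left(\frac{p}{4+(-1)^{(p-1)/4}}\right)$ is the Legendre symbol modulo the prime $5$ or $3$. *)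

(* Defs.v *)
From mathcomp Require Import all_boot all_order all_algebra.

Set Implicit Arguments.
Unset Strict Implicit.
Unset Printing Implicit Defensive.

Import GRing.Theory Num.Theory.
Local Open Scope ring_scope.

(* x only needs to range over representatives modulo p. *)
Definition quad_residue (p : nat) (a : int) : bool :=
  ~~ (p%:Z %| a)%Z && [exists x : 'I_p, ((x%:Z ^+ 2)%R == a %[mod p%:Z])%Z].

(* Meaningful for p an odd prime. *)
Definition legendre (a : int) (p : nat) : int :=
  if (p%:Z %| a)%Z then 0 else if quad_residue p a then 1 else -1.

(* alpha lists integer representatives of the nonzero quadratic residue classes
   modulo p, each class exactly once. *)
Definition represents_quad_residues (p : nat) (alpha : 'I_(p.-1)./2 -> int) : Prop :=
  (forall i j, (alpha i = alpha j %[mod p%:Z])%Z -> i = j) /\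
  (forall a : int, quad_residue p a <-> exists i, (a = alpha i %[mod p%:Z])%Z).

(* The determinant depends on the chosen representatives alpha (its residue
   modulo p does not). *)
Definition S2 (p : nat) (alpha : 'I_(p.-1)./2 -> int) (n : nat) (d : int) : int :=
  \det (\matrix_(i < (p.-1)./2, j < (p.-1)./2) (alpha i + d * alpha j) ^+ n).

(* Main.v *)
Require Import Defs.
From mathcomp Require Import all_boot all_order all_algebra.
From mathcomp Require Import perm fieldext galois finfield.
From mathcomp Require Import zify ring.

(* Put m = (p-1)/2 = 2q and work in F_p, where Euler's criterion turns the
   Legendre symbol of s into s^m = (s^2)^q = (det A)^q with A the reduction of
   the matrix; so no square root of the determinant has to be identified.
   The residues a_i are the roots of X^m - 1, so expanding (a_i - a_j)^(m+3)
   and folding exponents modulo m factors A as W C V^T with C diagonal, made of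
   (folded) binomial coefficients, and det V * det W = - m^m by orthogonality.
   Hence (det A)^q is a product of quadratic symbols of factorials, which the
   half factorial (2q)!^2 = -1 and the superfactorial reduce to the symbols of
   2, 3, 5 and q!; the symbol of q! is the sign in the theorem, and those of 3
   and 5 are computed with Gauss sums. The matrix being too small for the
   folding when p = 5, that case is treated directly.
   The integral square root comes from the fact that the determinant of a
   skew-symmetric matrix over a field is a square, by Schur complements. *)

Import GRing.Theory Num.Theory.
Local Open Scope ring_scope.

(** * Skew-symmetric determinants *)

Lemma skew_mxE (R : nzRingType) (n : nat) (A : 'M[R]_n) :
  A^T = - A -> forall i j, A i j = - A j i.
Proof. by move=> /matrixP skewA i j; have := skewA j i; rewrite !mxE. Qed.

Lemma skew_mx_diag (F : fieldType) (n : nat) (A : 'M[F]_n) :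
  2%:R != 0 :> F -> A^T = - A -> forall i, A i i = 0.
Proof.
move=> two_neq0 skewA i; apply/eqP; have /eqP := skew_mxE _ _ _ skewA i i.
by rewrite -subr_eq0 opprK -mulr2n -mulr_natl mulf_eq0 (negPf two_neq0).
Qed.

Lemma det_mx22 (R : comNzRingType) (A : 'M[R]_2) :
  \det A = A 0 0 * A 1 1 - A 0 1 * A 1 0.
Proof.
rewrite (expand_det_row _ 0) !big_ord_recl big_ord0 /cofactor !det_mx11 !mxE.
have -> : lift ord0 (0 : 'I_1) = 1 :> 'I_2 by apply: val_inj.
have -> : lift 1 (0 : 'I_1) = 0 :> 'I_2 by apply: val_inj.
by rewrite expr0 expr1 mul1r mulN1r mulrN addr0.
Qed.

(** Induction on the size in steps of two. A nonzero entry of the first row is moved next to the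
    diagonal; the leading 2 by 2 block then has the square of that entry as determinant, and its
    Schur complement is again skew-symmetric. *)
Lemma det_skew_sqr (F : fieldType) (n : nat) (A : 'M[F]_n) :
  2%:R != 0 :> F -> A^T = - A -> exists x : F, \det A = x ^+ 2.
Proof.
move=> two_neq0; have [k le_nk] := ubnP n.
elim: k => // k IHk in n A le_nk *; move: n => [|[|n]] in A le_nk * => skewA.
- by exists 1; rewrite det_mx00 expr1n.
- by exists 0; rewrite det_mx11 skew_mx_diag // expr0n.
have diagE := skew_mx_diag _ _ _ two_neq0 skewA.
have [/forallP A0 | /forallPn[j A0j_neq0]] := boolP [forall j, A 0 j == 0].
  exists 0; rewrite (expand_det_row _ 0) expr0n big1 // => j _.
  by rewrite (eqP (A0 j)) mul0r.
(* Conjugating by a transposition keeps determinant and skew-symmetry, and brings [A 0 j] to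
   position (0, 1); [j] is not 0 because the diagonal vanishes. *)
pose P : 'M[F]_n.+2 := perm_mx (tperm (lift ord0 ord0) j).
have [B [detB skewB B01]] : exists B : 'M[F]_n.+2,
    [/\ \det B = \det A, B^T = - B & B 0 (lift ord0 ord0) != 0].
  exists (P *m A *m P^T); split.
  - by rewrite !det_mulmx det_tr mulrAC det_perm -expr2 sqrr_sign mul1r.
  - by rewrite !trmx_mul trmxK skewA mulNmx mulmxN mulmxA.
  - rewrite /P tr_perm_mx -row_permE -col_permE !mxE tpermL tpermD //.
    by apply: contraNneq A0j_neq0 => ->; rewrite diagE.
rewrite -detB; clear A skewA diagE j A0j_neq0 P detB.
have skewE := skew_mxE _ _ _ skewB.
have diagE := skew_mx_diag _ _ _ two_neq0 skewB.
change ('M[F]_(2 + n)) in B.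
pose J := ulsubmx B; pose U := ursubmx B; pose D := drsubmx B.
have defB : B = block_mx J U (- U^T) D.
  rewrite -{1}[B]submxK; congr block_mx.
  by apply/matrixP=> i i'; rewrite !mxE skewE.
have detJ : \det J = B 0 (lift ord0 ord0) ^+ 2.
  have lsh (i : 'I_2) : lshift n i = inord i :> 'I_n.+2.
    by apply: val_inj; rewrite /= inordK // (leq_trans (ltn_ord i)).
  rewrite det_mx22 ![J _ _]mxE ![usubmx B _ _]mxE !lsh !diagE mul0r add0r.
  rewrite (skewE (inord (1%R : 'I_2))) mulrN opprK expr2.
  have -> : inord (0%R : 'I_2) = 0 :> 'I_n.+2 by apply: val_inj; rewrite /= inordK.
  by have -> : inord (1%R : 'I_2) = lift ord0 ord0 :> 'I_n.+2
    by apply: val_inj; rewrite /= inordK.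
have Junit : J \in unitmx by rewrite unitmxE detJ unitfE expf_neq0.
have skewJ : J^T = - J by apply/matrixP=> i i'; rewrite !mxE skewE.
have skewJV : (invmx J)^T = - invmx J.
  rewrite trmx_inv skewJ -scaleN1r invmxZ ?unitrN1 // ?invrN1 ?scaleN1r //.
  by rewrite -skewJ unitmx_tr.
have [] := IHk n (D + U^T *m invmx J *m U).
- by lia.
- rewrite linearD /= !trmx_mul trmxK skewJV mulNmx mulmxN mulmxA opprD.
  by congr (_ - _); apply/matrixP=> i i'; rewrite !mxE skewE.
move=> y detS; exists (B 0 (lift ord0 ord0) * y).
rewrite exprMn -detJ -detS.
(* Block LU factorisation; the last diagonal block is the Schur complement of [J]. *)
have -> : B = block_mx J 0 (- U^T) 1%:M *m
              block_mx 1%:M (invmx J *m U) 0 (D + U^T *m invmx J *m U).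
  rewrite mulmx_block !mulmx1 !mulmx0 !mul0mx !mul1mx !addr0 mulKVmx //.
  by rewrite mulNmx addrCA mulmxA addNr addr0.
rewrite det_mulmx.
have detL := det_lblock J (- U^T) (1%:M : 'M_n).
have detR := det_ublock (1%:M : 'M_2) (invmx J *m U) (D + U^T *m invmx J *m U).
rewrite !det1 mulr1 mul1r in detL detR.
exact: congr2 detL detR.
Qed.

(** The denominator of [x] divides the square of the numerator, to which it is coprime, so it is
    1. *)
Lemma int_sqr_of_rat (a : int) (x : rat) :
  a%:~R = x ^+ 2 -> exists s : int, s ^+ 2 = a.
Proof.
move=> ax2.
have numE : numq x ^+ 2 = a * denq x ^+ 2.
  apply/eqP; rewrite -(eqr_int rat) intrM !rmorphXn /= ax2.
  by rewrite numqE exprMn.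
have : (`|denq x| %| `|numq x| ^ 2)%N.
  by rewrite -abszX numE abszM abszX dvdn_mull // dvdn_mulr.
rewrite Gauss_dvdr; last by rewrite coprime_sym coprime_num_den.
move=> d_dvd; have d1 : `|denq x|%N = 1%N.
  apply/eqP; rewrite -dvdn1 -(eqP (coprime_num_den x)).
  by rewrite dvdn_gcd d_dvd dvdnn.
exists (numq x); rewrite numE.
have := denq_gt0 x; case: (denq x) d1 => // d /= -> _.
by rewrite expr1n mulr1.
Qed.

Lemma det_skew_int_sqr (n : nat) (A : 'M[int]_n) :
  A^T = - A -> exists s : int, s ^+ 2 = \det A.
Proof.
move=> skewA; have [||x detE] := @det_skew_sqr rat n (map_mx intr A) => //.
  by apply/matrixP=> i j; rewrite !mxE (skew_mxE _ _ _ skewA) rmorphN.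
by apply: (@int_sqr_of_rat _ x); rewrite -det_map_mx.
Qed.

(** * Powers of differences of roots of unity *)

Lemma Xn_sub_1_unity_roots (F : fieldType) (m : nat) (a : 'I_m -> F) :
  (0 < m)%N -> injective a -> (forall i, a i ^+ m = 1) ->
  'X^m - 1 = \prod_(i < m) ('X - (a i)%:P).
Proof.
move=> m_gt0 a_inj aX; pose rs := [seq a i | i <- enum 'I_m].
have size_rs : size rs = m by rewrite size_map size_enum_ord.
rewrite (@all_roots_prod_XsubC _ ('X^m - 1) rs).
- by rewrite (monicP (monicXnsubC 1 m_gt0)) scale1r big_map big_enum.
- by rewrite size_XnsubC ?size_rs.
- apply/allP=> _ /mapP[i _ ->]; rewrite rootE !hornerE ?hornerXn aX subrr //.
- by rewrite uniq_rootsE map_inj_uniq // enum_uniq.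
Qed.

Lemma unity_root_enum (F : fieldType) (m : nat) (a : 'I_m -> F) (x : F) :
  (0 < m)%N -> injective a -> (forall i, a i ^+ m = 1) ->
  x ^+ m = 1 -> exists i, a i = x.
Proof.
move=> m_gt0 a_inj aX xX.
have /(congr1 (horner^~ x)) := Xn_sub_1_unity_roots _ _ _ m_gt0 a_inj aX.
rewrite horner_prod !hornerE ?hornerXn xX subrr => /esym/eqP.
case/prodf_eq0=> i _; rewrite !hornerE subr_eq0 => /eqP xE.
by exists i.
Qed.

Lemma prod_unity_roots (F : fieldType) (m : nat) (a : 'I_m -> F) :
  (0 < m)%N -> injective a -> (forall i, a i ^+ m = 1) ->
  \prod_i a i = - (-1) ^+ m.
Proof.
move=> m_gt0 a_inj aX.
have /(congr1 (horner^~ 0)) := Xn_sub_1_unity_roots _ _ _ m_gt0 a_inj aX.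
rewrite horner_prod !hornerE ?hornerXn expr0n eqn0Ngt m_gt0 /= sub0r => prodE.
have {}prodE : -1 = (-1) ^+ m * \prod_i a i.
  rewrite -[in (-1) ^+ m](card_ord m) -prodrN prodE.
  by apply: eq_bigr => i _; rewrite !hornerE.
by rewrite -mulrN1 {2}prodE mulrA -expr2 sqrr_sign mul1r.
Qed.

(** Multiplication by a root [a j] permutes the roots and scales the sum by [a j ^+ t]. If m does
    not divide t, some [j] makes this factor differ from 1, since X^(t mod m) - 1 has fewer than m
    roots. *)
Lemma sum_unity_roots_expr (F : fieldType) (m : nat) (a : 'I_m -> F) (t : nat) :
  (0 < m)%N -> injective a -> (forall i, a i ^+ m = 1) ->
  \sum_i a i ^+ t = if (m %| t)%N then m%:R else 0.
Proof.
move=> m_gt0 a_inj aX; case: ifPn => [/dvdnP[k ->]|ndvd].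
  under eq_bigr => i _ do rewrite mulnC exprM aX expr1n.
  by rewrite sumr_const card_ord.
have t_mod : (0 < t %% m)%N by rewrite lt0n.
have [j ajt] : exists j, a j ^+ t != 1.
  apply/existsP; apply: contraLR (ltn_pmod t m_gt0) => /existsPn all1.
  suff : (size [seq a i | i <- enum 'I_m] < size ('X^(t %% m) - 1 : {poly F})%R)%N.
    by rewrite size_XnsubC // size_map size_enum_ord ltnS -leqNgt.
  apply: max_poly_roots.
  - by rewrite -size_poly_eq0 size_XnsubC.
  - apply/allP=> _ /mapP[i _ ->]; rewrite rootE !hornerE ?hornerXn.
    by rewrite expr_mod // subr_eq0 -[_ == _]negbK all1.
  - by rewrite map_inj_uniq // enum_uniq.
have aj_neq0 : a j != 0.
  by apply: contra_eq_neq (aX j) => ->; rewrite expr0n eqn0Ngt m_gt0 eq_sym oner_neq0.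
have /fin_all_exists[f fE] i : exists k, a k = a j * a i.
  by apply: unity_root_enum => //; rewrite exprMn !aX mulr1.
have f_inj : injective f.
  by move=> i k /(congr1 a); rewrite !fE => /(mulfI aj_neq0)/a_inj.
have : \sum_i a i ^+ t = a j ^+ t * \sum_i a i ^+ t.
  rewrite {1}(reindex_inj f_inj) mulr_sumr.
  by apply: eq_bigr => i _; rewrite fE exprMn.
move/eqP; rewrite -subr_eq0 -{1}[\sum_i _]mul1r -mulrBl mulf_eq0 subr_eq0 eq_sym.
by rewrite (negPf ajt) => /eqP.
Qed.

(** The binomial terms of index k and m + k carry the same powers of x and y up to m-th powers,
    which are 1. Only k <= 3 receives a second term. *)
Lemma exprB_unity_roots (F : fieldType) (m : nat) (x y : F) :
  (3 < m)%N -> x ^+ m = 1 -> y ^+ m = 1 ->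
  (x - y) ^+ (3 + m) =
  \sum_(k < m) x ^+ (3 + m - k) *
     ((-1) ^+ k * ('C(3 + m, k)%:R + (-1) ^+ m * 'C(3 + m, m + k)%:R)) * y ^+ k.
Proof.
move=> m_gt3 xm ym.
pose G k := (-1) ^+ k * x ^+ (3 + m - k) * y ^+ k *+ 'C(3 + m, k).
(* Padding with zero binomials up to 2m terms lets the sum split into two blocks of length m. *)
have -> : (x - y) ^+ (3 + m) = \sum_(k < m + m) G k.
  rewrite exprBn -[RHS](big_mkord xpredT G).
  rewrite (big_cat_nat (n := (3 + m).+1)) //=; last by lia.
  rewrite big_mkord [X in _ = _ + X]big_nat_cond [X in _ = _ + X]big1 ?addr0 //.
  by move=> k /andP[/andP[lt_k _] _]; rewrite /G bin_small.
rewrite big_split_ord /= -big_split; apply: eq_bigr => k _ /=.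
rewrite /G /= !exprD ym mul1r.
have [k_le3|k_gt3] := leqP k 3; last first.
  have bin0 : 'C(3 + m, m + k) = 0%N by rewrite bin_small //; lia.
  by rewrite bin0 !mulr0n mulr0 !addr0 -mulr_natr; ring.
have -> : (3 + m - (m + k) = 3 - k)%N by lia.
have -> : (3 + m - k = m + (3 - k))%N by lia.
by rewrite exprD xm -[_ *+ 'C(_, k)]mulr_natr -[_ *+ 'C(_, m + k)]mulr_natr; ring.
Qed.

(** Neither of the two Vandermonde-like determinants is computed: orthogonality of the roots gives
    their product. *)
Lemma det_exprB_unity_roots (F : fieldType) (m : nat) (a : 'I_m -> F) :
  (3 < m)%N -> ~~ odd m -> injective a -> (forall i, a i ^+ m = 1) ->
  \det (\matrix_(i, j) (a i - a j) ^+ (3 + m)) =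
  - (m%:R ^+ m) *
  \prod_(k < m) ((-1) ^+ k * ('C(3 + m, k)%:R + 'C(3 + m, m + k)%:R)).
Proof.
move=> m_gt3 m_even a_inj aX; have m_gt0 : (0 < m)%N by lia.
have sgn_m : (-1) ^+ m = 1 :> F by rewrite -signr_odd (negPf m_even).
pose V : 'M[F]_m := \matrix_(i, k) a i ^+ k.
pose W : 'M[F]_m := \matrix_(i, k) a i ^+ (3 + m - k).
pose c : 'rV[F]_m :=
  \row_k ((-1) ^+ k * ('C(3 + m, k)%:R + 'C(3 + m, m + k)%:R)).
have -> : \matrix_(i, j) (a i - a j) ^+ (3 + m) = W *m diag_mx c *m V^T.
  apply/matrixP=> i j; rewrite mul_mx_diag !mxE exprB_unity_roots //.
  by apply: eq_bigr => k _; rewrite !mxE sgn_m mul1r.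
(* The weights a_i^(m-3) bring the exponent of a_i to m + (k + m - l), which m divides only if k =
   l. *)
have : V^T *m diag_mx (\row_i a i ^+ (m - 3)) *m W = m%:R%:M.
  apply/matrixP=> k l; rewrite mul_mx_diag !mxE.
  transitivity (\sum_i a i ^+ (k + m - l)).
    apply: eq_bigr => i _; rewrite !mxE -!exprD.
    have -> : (k + (m - 3) + (3 + m - l) = m + (k + m - l))%N.
      by have := ltn_ord l; lia.
    by rewrite exprD aX mul1r.
  rewrite sum_unity_roots_expr // -val_eqE /=.
  have := ltn_ord l; have := ltn_ord k => ltk ltl.
  case: eqP => [->|/eqP neq_kl]; first by rewrite addKn dvdnn.
  case: ifP => // /dvdnP[n]; move: neq_kl; case: n => [|[|n]]; nia.
move/(congr1 determinant); rewrite !det_mulmx !det_diag det_tr det_scalar.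
under eq_bigr => i _ do rewrite mxE.
(* For even m the roots have product -1, so the weights have determinant (-1)^(m-3) = -1: this is
   the minus sign of the statement. *)
rewrite prodrXl prod_unity_roots // sgn_m -[(-1) ^+ _]signr_odd oddB 1?ltnW //.
rewrite (negPf m_even) expr1 mulrN1 mulNr => detVW.
rewrite -detVW; under eq_bigr => k _ do rewrite mxE.
by ring.
Qed.

(** * Quadratic symbols of factorials, 2, 3 and 5 *)

Lemma double_fact_odd (q : nat) :
  ((2 * q)`! = \prod_(k < q) (2 * k).+1 * 2 ^ q * q`!)%N.
Proof.
elim: q => [|q IHq]; first by rewrite big_ord0.
have -> : (2 * q.+1 = (2 * q).+2)%N by lia.
rewrite big_ord_recr /= !factS IHq expnS.
by ring.
Qed.

(** Consecutive factorials are paired: (2k)! (2k+1)! = (2k)!^2 (2k+1). *)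
Lemma superfactorial_double (q : nat) :
  (\prod_(k < 2 * q) k`! =
   (\prod_(k < q) (2 * k)`!) ^ 2 * \prod_(k < q) (2 * k).+1)%N.
Proof.
elim: q => [|q IHq]; first by rewrite !big_ord0.
have -> : (2 * q.+1 = (2 * q).+2)%N by lia.
rewrite !big_ord_recr /= IHq factS.
by ring.
Qed.

(** The reflection of k to m + 3 - k preserves the range, so the squared product supplies both k!
    and (m + 3 - k)! for each binomial. *)
Lemma prod_bin_fact (m : nat) :
  (\prod_(4 <= k < m) 'C(3 + m, k) * (\prod_(4 <= k < m) k`!) ^ 2 =
   (3 + m)`! ^ (m - 4))%N.
Proof.
rewrite -mulnn [X in (_ * (_ * X))%N]big_nat_rev -!big_split -prod_nat_const_nat /=.
rewrite big_nat_cond [RHS]big_nat_cond; apply: eq_bigr => k.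
case/andP=> /andP[k_ge4 lt_km] _.
have -> : (4 + m - k.+1 = 3 + m - k)%N by lia.
by rewrite bin_fact //; lia.
Qed.

Lemma Fp_natr_neq0 (p n : nat) :
  prime p -> (0 < n < p)%N -> n%:R != 0 :> 'F_p.
Proof.
move=> p_prime /andP[n_gt0 lt_np].
by rewrite -(dvdn_pcharf (pchar_Fp p_prime)) gtnNdvd.
Qed.

Lemma Fp_fact_neq0 (p n : nat) : prime p -> (n < p)%N -> n`!%:R != 0 :> 'F_p.
Proof.
move=> p_prime; elim: n => [|n IHn] lt_np; first by rewrite oner_neq0.
by rewrite factS natrM mulf_neq0 ?IHn ?Fp_natr_neq0 // ltnW.
Qed.

Lemma Fp_fermat (p : nat) (x : 'F_p) : prime p -> x != 0 -> x ^+ p.-1 = 1.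
Proof.
move=> p_prime x_neq0; apply: (mulfI x_neq0).
rewrite mulr1 -exprS prednK ?prime_gt0 //.
by have := @expf_card 'F_p x; rewrite card_Fp.
Qed.

(** Induction from Wilson's theorem: each step trades the factor p - (n + 1) for n + 1, a change of
    sign modulo p. *)
Lemma Fp_fact_compl (p n : nat) : prime p -> (n < p)%N ->
  (n`! * (p.-1 - n)`!)%:R = (-1) ^+ n.+1 :> 'F_p.
Proof.
move=> p_prime; have p_gt1 := prime_gt1 p_prime.
have wilson : (p.-1)`!%:R = -1 :> 'F_p.
  apply/eqP; rewrite -subr_eq0 opprK natr1 -(dvdn_pcharf (pchar_Fp p_prime)).
  by rewrite -Wilson.
elim: n => [|n IHn] lt_np; first by rewrite mul1n subn0 wilson.
have := IHn (ltnW lt_np).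
have -> : (p.-1 - n = (p.-1 - n.+1).+1)%N by lia.
rewrite factS [in n.+1`!]factS => IH.
have pE : ((p.-1 - n.+1).+1)%:R = - n.+1%:R :> 'F_p.
  apply/eqP; rewrite -subr_eq0 opprK -natrD.
  have -> : ((p.-1 - n.+1).+1 + n.+1 = p)%N by lia.
  by rewrite pchar_Fp_0.
by rewrite exprS -IH !natrM pE; ring.
Qed.

Lemma Fp_half_fact_sqr (p q : nat) :
  prime p -> p = (4 * q).+1 -> ((2 * q)`!%:R : 'F_p) ^+ 2 = -1.
Proof.
move=> p_prime def_p; have lt_p : (2 * q < p)%N by lia.
have := Fp_fact_compl _ _ p_prime lt_p.
have -> : (p.-1 - 2 * q = 2 * q)%N by lia.
rewrite natrM -expr2 => ->.
by rewrite exprS exprM sqrrN !expr1n mulr1.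
Qed.

(* [i ^+ 2 = -1] gives [(1 + i) ^+ 2 = 2 * i]. *)
Lemma Fp_two_half (p q : nat) :
  prime p -> p = (4 * q).+1 -> (2%:R : 'F_p) ^+ (2 * q) = (-1) ^+ q.
Proof.
move=> p_prime def_p; have i2 := @Fp_half_fact_sqr p q p_prime def_p.
move: (_%:R) i2 => i i2.
have p_gt1 := prime_gt1 p_prime.
have two_neq0 : 2%:R != 0 :> 'F_p by rewrite Fp_natr_neq0 //; lia.
have i1_neq0 : 1 + i != 0.
  apply: contraNneq two_neq0 => i1.
  have defi : i = -1 by apply/eqP; rewrite -addr_eq0 addrC i1.
  by apply/eqP; rewrite -[2%:R]/(1 + 1) -{1}[1]opprK -i2 defi; ring.
have := @Fp_fermat p _ p_prime i1_neq0.
have -> : p.-1 = (2 * (2 * q))%N by lia.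
have i1sq : (1 + i) ^+ 2 = 2%:R * i by ring: i2.
rewrite exprM i1sq exprMn (exprM i) i2 => h.
by apply: (mulIf (negbT (signr_eq0 _ q))); rewrite h -expr2 sqrr_sign.
Qed.

Lemma Fp_poly_root_ext (p : nat) (P : {poly 'F_p}) :
  (1 < size P)%N ->
  exists (L : fieldType) (f : {rmorphism 'F_p -> L}) (z : L),
    root (map_poly f P) z.
Proof.
move=> sP; have P_neq0 : P != 0 by rewrite -size_poly_gt0 ltnW.
have [L [rs eqP_rs _]] := FinSplittingFieldFor P_neq0.
exists L, (GRing.in_alg L); case: rs eqP_rs => [|z rs] eqP_rs.
  have := eqp_size eqP_rs.
  by rewrite big_nil size_poly1 size_map_poly => sP1; rewrite sP1 in sP.
exists z; rewrite (eqp_root eqP_rs) rootE big_cons hornerM.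
by rewrite !hornerE subrr mul0r.
Qed.

(* Gauss sum: in an extension with a primitive cube root of unity [z], the
   element [g := z - z ^+ 2] satisfies [g ^+ 2 = -3] and [g ^+ p = +- g]. *)
Lemma Fp_three_half (p q : nat) : prime p -> p = (4 * q).+1 ->
  (3%:R : 'F_p) ^+ (2 * q) = if (p %% 3 == 1)%N then 1 else -1.
Proof.
move=> p_prime def_p; have p_gt1 := prime_gt1 p_prime.
pose P : {poly 'F_p} := 'X^2 + 'X + 1%:P.
have sP : size P = 3 by rewrite /P -addrA size_polyDl size_polyXn // size_XaddC.
have [|L [f [z]]] := @Fp_poly_root_ext p P; first by rewrite sP.
rewrite rootE !rmorphD /= map_polyXn map_polyX map_polyC /= rmorph1 !hornerD !hornerXn.
rewrite hornerX hornerC => /eqP z0.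
have chL : p \in [pchar L] by rewrite (fmorph_pchar f) pchar_Fp.
have z3 : z ^+ 3 = 1 by rewrite -[LHS]subr0 -(mulr0 (z - 1)) -z0; ring.
pose g := z - z ^+ 2.
have g2 : g ^+ 2 = - 3%:R.
  (* The cofactor is the quotient of g^2 + 3 by z^2 + z + 1. *)
  by rewrite -[LHS]subr0 -(mulr0 (z ^+ 2 - 3%:R * z + 3%:R)) -z0 /g; ring.
have g_neq0 : g != 0.
  apply: contra_eq_neq g2 => ->; rewrite expr0n eq_sym oppr_eq0.
  by rewrite -(rmorph_nat f) fmorph_eq0 Fp_natr_neq0 //; lia.
have gp : g ^+ p = (f 3%:R) ^+ (2 * q) * g.
  have def_p2 : p = (2 * (2 * q)).+1 by lia.
  rewrite [X in g ^+ X]def_p2 exprSr exprM g2 exprNn rmorph_nat exprM.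
  by rewrite sqrrN !expr1n mul1r.
(* Second evaluation of g^p: Frobenius multiplies the exponents by p, so g is kept or negated
   according to p mod 3. *)
have gp' : g ^+ p = z ^+ (p %% 3) - z ^+ (2 * p %% 3).
  rewrite -(pFrobenius_autE chL) rmorphB /= !pFrobenius_autE -exprM.
  by rewrite (expr_mod _ z3) (expr_mod _ z3).
apply: (fmorph_inj f); apply: (mulIf g_neq0).
rewrite rmorphXn -gp gp' -modnMmr.
have : ~~ (3 %| p)%N by rewrite dvdn_prime2 //; lia.
rewrite /dvdn.
have := ltn_pmod p (isT : 0 < 3)%N; move: (p %% 3)%N => [|[|[|r]]] //= _ _.
  by rewrite rmorph1 mul1r expr1.
by rewrite rmorphN1 mulN1r opprB.
Qed.

(** Gauss sum modulo 5: the signs in [g] are the quadratic characters of the exponents, so g^2 = 5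
    and Frobenius multiplies g by the character of p. *)
Lemma Fp_five_half (p q : nat) : prime p -> p = (4 * q).+1 -> p != 5%N ->
  (5%:R : 'F_p) ^+ (2 * q) =
  if (p %% 5 == 1)%N || (p %% 5 == 4)%N then 1 else -1.
Proof.
move=> p_prime def_p p_neq5; have p_gt1 := prime_gt1 p_prime.
pose P : {poly 'F_p} := 'X^4 + ('X^3 + ('X^2 + ('X + 1%:P))).
have sP : size P = 5.
  have s2 : size ('X^2 + ('X + 1%:P) : {poly 'F_p}) = 3.
    by rewrite size_polyDl size_polyXn // size_XaddC.
  have s3 : size ('X^3 + ('X^2 + ('X + 1%:P)) : {poly 'F_p}) = 4.
    by rewrite size_polyDl size_polyXn // s2.
  by rewrite size_polyDl size_polyXn // s3.
have [|L [f [z]]] := @Fp_poly_root_ext p P; first by rewrite sP.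
rewrite rootE !rmorphD /= !map_polyXn map_polyX map_polyC /= rmorph1 !hornerD !hornerXn.
rewrite hornerX hornerC => /eqP z0.
have chL : p \in [pchar L] by rewrite (fmorph_pchar f) pchar_Fp.
have z5 : z ^+ 5 = 1 by rewrite -[LHS]subr0 -(mulr0 (z - 1)) -z0; ring.
pose g := z - z ^+ 2 - z ^+ 3 + z ^+ 4.
have g2 : g ^+ 2 = 5%:R.
  (* the quotient of [g ^+ 2 - 5] by the cyclotomic polynomial *)
  pose r := z ^+ 4 - 3%:R * z ^+ 3 + z ^+ 2 + 5%:R * z - 5%:R.
  by rewrite -[LHS]subr0 -(mulr0 r) -z0 /r /g; ring.
have g_neq0 : g != 0.
  apply: contra_eq_neq g2 => ->; rewrite expr0n eq_sym.
  by rewrite -(rmorph_nat f) fmorph_eq0 Fp_natr_neq0 //; lia.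
have gp : g ^+ p = (f 5%:R) ^+ (2 * q) * g.
  have def_p2 : p = (2 * (2 * q)).+1 by lia.
  by rewrite [X in g ^+ X]def_p2 exprSr exprM g2 rmorph_nat.
have gp' : g ^+ p = z ^+ (p %% 5) - z ^+ (2 * p %% 5) - z ^+ (3 * p %% 5)
                    + z ^+ (4 * p %% 5).
  rewrite -(pFrobenius_autE chL) rmorphD !rmorphB /= !pFrobenius_autE -!exprM.
  by rewrite !(expr_mod _ z5).
apply: (fmorph_inj f); apply: (mulIf g_neq0).
rewrite rmorphXn -gp gp' -(modnMmr 2) -(modnMmr 3) -(modnMmr 4).
have : ~~ (5 %| p)%N by rewrite dvdn_prime2 //; lia.
rewrite /dvdn.
have := ltn_pmod p (isT : 0 < 5)%N.
move: (p %% 5)%N => [|[|[|[|[|r]]]]] //= _ _; rewrite ?rmorph1 ?rmorphN1 /g; ring.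
Qed.

(** * The quadratic symbol of the determinant *)

Lemma prod_sign_double (R : comNzRingType) (q : nat) :
  \prod_(k < 2 * q) (-1) ^+ k = (-1) ^+ q :> R.
Proof.
elim: q => [|q IHq]; first by rewrite big_ord0.
have -> : (2 * q.+1 = (2 * q).+2)%N by lia.
rewrite !big_ord_recr /= IHq -mulrA -exprD addnS exprS addnn -mul2n exprM.
by rewrite sqrrN expr1n expr1n mulr1 -exprSr.
Qed.

(** By symmetry of the binomials, the folded coefficients of index k and 3 - k agree for k <= 3;
    hence the square. *)
Lemma prod_fold_bin (R : comNzRingType) (m : nat) : (3 < m)%N ->
  \prod_(k < m) ('C(3 + m, k)%:R + 'C(3 + m, m + k)%:R) =
  ((1 + 'C(3 + m, 3)%:R) * ((3 + m)%:R + 'C(3 + m, 2)%:R)) ^+ 2 *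
  (\prod_(4 <= k < m) 'C(3 + m, k))%:R :> R.
Proof.
move=> m_gt3.
rewrite -(big_mkord xpredT (fun k => 'C(3 + m, k)%:R + 'C(3 + m, m + k)%:R)).
rewrite (big_cat_nat (n := 4)) //=; congr (_ * _); last first.
  rewrite natr_prod big_nat_cond [RHS]big_nat_cond; apply: eq_bigr => k.
  by case/andP=> /andP[k_gt3 _] _; rewrite [X in _ + X%:R]bin_small ?addr0 //; lia.
have binE j : (j <= 3)%N -> 'C(3 + m, m + j) = 'C(3 + m, 3 - j).
  move=> le_j3; have -> : (m + j = 3 + m - (3 - j))%N by lia.
  by rewrite bin_sub //; lia.
rewrite 4?big_nat_recl // big_geq // mulr1 !binE // subn0 subnn !bin0 !bin1.
by ring.
Qed.

Lemma Fp_half_power_sqr (p q : nat) (x : 'F_p) : prime p -> p = (4 * q).+1 ->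
  x != 0 -> (x ^+ (2 * q)) ^+ 2 = 1.
Proof.
move=> p_prime def_p x_neq0; rewrite -exprM.
have -> : (2 * q * 2 = p.-1)%N by lia.
exact: Fp_fermat.
Qed.

(** [chi] is the quadratic character, so each factor matters only up to squares. The signs and the
    powers of 2 become powers of e = (-1)^q = chi 2 and cancel. As q > 2 forces p > 7, the primes 2,
    3, 5 and 7 are units. *)
Lemma Fp_det_power (p q : nat) : prime p -> p = (4 * q).+1 -> (2 < q)%N ->
  let chi (n : nat) := (n%:R : 'F_p) ^+ (2 * q) in
  (- ((2 * q)%:R ^+ (2 * q)) *
   \prod_(k < 2 * q)
      ((-1) ^+ k * ('C(3 + 2 * q, k)%:R + 'C(3 + 2 * q, 2 * q + k)%:R))) ^+ q =
  chi 5%N * (chi 3%N * chi 5%N) ^+ q * chi q`! :> 'F_p.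
Proof.
move=> p_prime def_p q_gt2 chi.
have chiM n1 n2 : chi (n1 * n2)%N = chi n1 * chi n2.
  by rewrite /chi natrM exprMn.
have chi_sqr n : (0 < n < p)%N -> chi n ^+ 2 = 1.
  by move=> n_p; apply: Fp_half_power_sqr; rewrite // Fp_natr_neq0.
have chi_fact n : (n < p)%N -> chi n`! ^+ 2 = 1.
  by move=> n_p; apply: Fp_half_power_sqr; rewrite // Fp_fact_neq0.
set e : 'F_p := (-1) ^+ q.
have e2 : e ^+ 2 = 1 by rewrite sqrr_sign.
have eq_e : e ^+ q = e by rewrite /e -exprM -(signr_odd _ (q * q)) oddM andbb signr_odd.
have chi2 : chi 2%N = e by apply: Fp_two_half.
have u2 : chi 3%N ^+ 2 = 1 by apply: chi_sqr; lia.
have v2 : chi 5%N ^+ 2 = 1 by apply: chi_sqr; lia.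
have s2 : chi 7%N ^+ 2 = 1 by apply: chi_sqr; lia.
have w2 : chi q`! ^+ 2 = 1 by apply: chi_fact; lia.
(* With m = 2q this is 2m = p - 1; it turns polynomials in m into constants below. *)
have double_m : 2%:R * (2 * q)%:R = -1 :> 'F_p.
  apply/eqP; rewrite -subr_eq0 opprK -natrM natr1.
  have -> : (2 * (2 * q)).+1 = p by lia.
  by rewrite pchar_Fp_0.
have chi_m : chi (2 * q)%N = e.
  have : chi (2 * (2 * q))%N = 1.
    by rewrite /chi natrM double_m exprM sqrrN !expr1n.
  rewrite chiM chi2 => em; rewrite -[LHS]mul1r -e2 expr2 -mulrA em mulr1 //.
have chi_half_fact : chi (2 * q)`! = e.
  by rewrite /chi exprM (Fp_half_fact_sqr _ _ p_prime def_p).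
pose O := (\prod_(k < q) (2 * k).+1)%N.
(* In (2q)! = O 2^q q!, both (2q)! and 2^q have symbol e. *)
have chiO : chi O = chi q`!.
  have := double_fact_odd q => /(congr1 chi).
  rewrite !chiM chi_half_fact -/O => h.
  have chi2q : chi (2 ^ q)%N = e.
    by rewrite /chi natrX -exprM mulnC exprM -/(chi 2%N) chi2.
  have : e * e * chi q`! = e * e * chi O * chi q`! ^+ 2.
    by rewrite {1}h chi2q; ring.
  by rewrite w2 -expr2 e2 !mul1r mulr1.
pose F := (\prod_(4 <= k < 2 * q) k`!)%N.
(* The superfactorial is O times a square, and the factors 0! 1! 2! 3! = 12 left out of [F] have the
   symbol of 3. *)
have chiF : chi F = chi 3%N * chi q`!.
  have := superfactorial_double q.
  rewrite -(big_mkord xpredT (fun k => k`!)) (big_cat_nat (n := 4)) //=; last by lia.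
  rewrite -/F -/O 4?big_nat_recl // big_geq // => /(congr1 chi).
  have -> : (0`! * (1`! * (2`! * (3`! * 1))) = 2 * 2 * 3)%N by [].
  have chiD : chi (\prod_(k < q) (2 * k)`!)%N ^+ 2 = 1.
    rewrite /chi natr_prod; apply: Fp_half_power_sqr => //.
    by apply/prodf_neq0 => k _; rewrite Fp_fact_neq0 //; have := ltn_ord k; lia.
  rewrite -mulnn !chiM chi2 chiO -[chi (\prod_(k < q) (2 * k)`!)%N * _]expr2 chiD.
  by move=> h; rewrite -[LHS]mul1r -u2 -[chi 3%N ^+ 2]mul1r -e2; ring: h.
have chiM3 : chi (3 + 2 * q)`! = chi 3%N * chi 5%N.
  (* 8 (m+1)(m+2)(m+3) = (2m+2)(2m+4)(2m+6) = 1 * 3 * 5. *)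
  have h : 8%:R * (3 + 2 * q)`!%:R = 15%:R * (2 * q)`!%:R :> 'F_p.
    have -> : (3 + 2 * q)`! =
        ((2 * q + 3) * ((2 * q + 2) * ((2 * q + 1) * (2 * q)`!)))%N.
      by rewrite addn3 addn2 addn1 -!factS.
    move: (2 * q)%N double_m => m double_m.
    transitivity ((2%:R * m%:R + 6%:R) * (2%:R * m%:R + 4%:R) *
                  (2%:R * m%:R + 2%:R) * m`!%:R : 'F_p).
      by rewrite !natrM !natrD; ring.
    by rewrite double_m; ring.
  move: ((3 + 2 * q)`!) ((2 * q)`!) h chi_half_fact => M N h chiN.
  have : chi (8 * M)%N = chi (15 * N)%N by rewrite /chi !natrM h.
  rewrite -[8%N]/(2 * 2 * 2)%N -[15%N]/(3 * 5)%N !chiM chi2 chiN => hc.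
  have -> : chi M = e ^+ 2 * e ^+ 2 * chi M by rewrite e2 !mul1r.
  rewrite -[RHS]mul1r -e2.
  by transitivity (e * (e * e * e * chi M)); [ring | rewrite hc; ring].
pose S := (\prod_(4 <= k < 2 * q) 'C(3 + 2 * q, k))%N.
(* The q-th power of S F^2 = (m+3)!^(m-4) reads S^q chi(F) = chi((m+3)!)^(q-2), and the last
   exponent matters only modulo 2. *)
have chiS : (S%:R : 'F_p) ^+ q = (chi 3%N * chi 5%N) ^+ q * chi 3%N * chi q`!.
  have h : ((S%:R : 'F_p) * F%:R ^+ 2) ^+ q = (3 + 2 * q)`!%:R ^+ (2 * q - 4) ^+ q.
    have := prod_bin_fact (2 * q); rewrite -/S -/F => SF.
    by rewrite -natrX -natrM SF natrX.
  have : (S%:R : 'F_p) ^+ q * chi F = (chi 3%N * chi 5%N) ^+ q.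
    rewrite -chiM3 /chi -!exprM.
    move: h; rewrite exprMn -!exprM => ->.
    have -> : ((2 * q - 4) * q = 2 * q * (q - 2))%N by lia.
    have -> : (2 * q * q = 2 * q * (q - 2) + 2 * q * 2)%N by lia.
    rewrite exprD [X in _ * X](_ : _ = 1) ?mulr1 // exprM.
    by apply: Fp_half_power_sqr; rewrite // Fp_fact_neq0 //; lia.
  rewrite chiF => <-.
  rewrite -[LHS]mulr1 -u2 -[_ * _ ^+ 2]mulr1 -w2; ring.
pose B : 'F_p := (1 + 'C(3 + 2 * q, 3)%:R) * ((3 + 2 * q)%:R + 'C(3 + 2 * q, 2)%:R).
(* As [2 * m = -1], the two folded coefficients are [63 / 48] and [35 / 8]. *)
have hB : 384%:R * B = 2205%:R.
  have b3 : 'C(3 + 2 * q, 3)%:R * 6%:R =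
            (2 * q + 3)%:R * (2 * q + 2)%:R * (2 * q + 1)%:R :> 'F_p.
    rewrite -!natrM; congr (_%:R); apply: etrans (bin_ffact _ 3) _.
    by rewrite addnC !ffactnS ffactn0 muln1 mulnA; congr (_ * _ * _)%N; lia.
  have b2 : 'C(3 + 2 * q, 2)%:R * 2%:R = (2 * q + 3)%:R * (2 * q + 2)%:R :> 'F_p.
    rewrite -!natrM; congr (_%:R); apply: etrans (bin_ffact _ 2) _.
    by rewrite addnC !ffactnS ffactn0 muln1; congr (_ * _)%N; lia.
  move: b3 b2; rewrite /B [(3 + 2 * q)%:R]natrD.
  move: ('C(_, 3)%:R) ('C(_, 2)%:R) => c3 c2; rewrite ![(2 * q + _)%:R]natrD.
  move: ((2 * q)%:R) double_m => m double_m b3 b2.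
  transitivity ((48%:R + 8%:R * (c3 * 6%:R)) *
                (4%:R * (2%:R * m + 6%:R + c2 * 2%:R)) : 'F_p).
    by ring.
  rewrite b3 b2.
  transitivity ((48%:R + (2%:R * m + 6%:R) * (2%:R * m + 4%:R) * (2%:R * m + 2%:R)) *
     (4%:R * (2%:R * m + 6%:R) + (2%:R * m + 6%:R) * (2%:R * m + 4%:R)) : 'F_p).
    by ring.
  by rewrite double_m; ring.
(* 384 = 2^7 * 3 and 2205 = 3^2 * 5 * 7^2. *)
have chiB : B ^+ (2 * q) = e * chi 3%N * chi 5%N.
  have : chi 384%N * B ^+ (2 * q) = chi 2205%N by rewrite /chi -exprMn hB.
  rewrite (_ : 384 = 2 * 2 * 2 * 2 * 2 * 2 * 2 * 3)%N //.
  rewrite (_ : 2205 = 3 * 3 * 5 * 7 * 7)%N // !chiM chi2.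
  move/(congr1 ( *%R (e * chi 3%N))) => h.
  transitivity ((e ^+ 2) ^+ 4 * chi 3%N ^+ 2 * B ^+ (2 * q)).
    by rewrite e2 u2 expr1n !mul1r.
  transitivity (e * chi 3%N * (chi 3%N ^+ 2 * chi 5%N * chi 7%N ^+ 2)).
    by etransitivity; [|etransitivity; [exact: h|]]; ring.
  by rewrite u2 s2; ring.
rewrite big_split prod_sign_double prod_fold_bin; last by lia.
rewrite -/S -/B -/e -/(chi (2 * q)%N) chi_m.
(* The symbol of m cancels the product of the alternating signs. *)
have -> : - e * (e * (B ^+ 2 * S%:R)) = - (B ^+ 2 * S%:R).
  by rewrite -[in RHS](mul1r (B ^+ 2)) -e2; ring.
rewrite exprNn -/e exprMn chiS -exprM chiB.
transitivity (e ^+ 2 * chi 3%N ^+ 2 * (chi 5%N * (chi 3%N * chi 5%N) ^+ q * chi q`!)).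
  by ring.
by rewrite e2 u2 !mul1r.
Qed.

Lemma Fp_det_power_half (p q : nat) (a : 'I_(2 * q) -> 'F_p) :
  prime p -> p = (4 * q).+1 -> injective a -> (forall i, a i ^+ (2 * q) = 1) ->
  (\det (\matrix_(i, j) (a i - a j) ^+ (3 + 2 * q))) ^+ q =
  (if odd q then 3 else 5)%N%:R ^+ (2 * q) * q`!%:R ^+ (2 * q) :> 'F_p.
Proof.
move=> p_prime def_p a_inj aX.
have q_gt0 : (0 < q)%N by have := prime_gt1 p_prime; lia.
have [q_le2|q_gt2] := leqP q 2.
  (* q = 2 would make p = 9. *)
  have q1 : q = 1%N.
    case: q q_gt0 q_le2 def_p p_prime {a a_inj aX} => [|[|[|]]] // _ _ -> //.
  subst q p; rewrite expr1 det_mx22 !mxE.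
  have a01 : a 0 != a 1 by rewrite (inj_eq a_inj).
  have a0X : a 0 ^+ 2 = 1 by apply: aX.
  have a1X : a 1 ^+ 2 = 1 by apply: aX.
  have a1E : a 1 = - a 0.
    have : (a 0 - a 1) * (a 0 + a 1) == 0 by rewrite -subr_sqr a0X a1X subrr.
    by rewrite mulf_eq0 subr_eq0 (negPf a01) /= addrC addr_eq0 => /eqP.
  have five0 : 5%:R = 0 :> 'F_5 by apply: pchar_Fp_0.
  rewrite a1E -[(3 + 2 * 1)%N]/5%N -[(2 * 1)%N]/2%N -[1`!]/1%N [odd 1]/=.
  (* The determinant is (2 a_0)^10, and 2^10 = 203 * 5 + 9 with 9 = 3^2 the required value. *)
  transitivity ((a 0 ^+ 2) ^+ 5 * (203%:R * 5%:R + 9%:R)); first by ring.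
  by rewrite a0X five0; ring.
rewrite det_exprB_unity_roots //; [|lia|by rewrite oddM].
rewrite (Fp_det_power _ _ p_prime def_p q_gt2).
have sqr1 n : (0 < n < p)%N -> ((n%:R : 'F_p) ^+ (2 * q)) ^+ 2 = 1.
  by move=> n_p; apply: Fp_half_power_sqr; rewrite // Fp_natr_neq0.
have u2 : ((3%:R : 'F_p) ^+ (2 * q)) ^+ 2 = 1 by apply: sqr1; lia.
have v2 : ((5%:R : 'F_p) ^+ (2 * q)) ^+ 2 = 1 by apply: sqr1; lia.
(* Only the parity of q matters: chi 5 (chi 3 chi 5)^q is chi 3 for odd q and chi 5 for even q. *)
have even_pow (x : 'F_p) : x ^+ 2 = 1 -> x ^+ q = x ^+ odd q.
  by move=> x2; rewrite -{1}(odd_double_half q) exprD -mul2n exprM x2 expr1n mulr1.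
rewrite even_pow ?exprMn ?u2 ?v2 ?mulr1 //; congr (_ * _); case: (odd q).
  by rewrite expr1 mulrC -mulrA -expr2 v2 mulr1.
by rewrite !expr0 !mulr1.
Qed.

(** * Legendre symbols modulo 3 and 5, by enumeration *)

Lemma quad_residue_nat (n k : nat) :
  quad_residue k n%:Z = ~~ (k %| n)%N && [exists x : 'I_k, x ^ 2 == n %[mod k]].
Proof.
rewrite /quad_residue; congr (~~ _ && _).
by apply: eq_existsb => x; rewrite expr2 -PoszM !modz_nat eqz_nat mulnn.
Qed.

Lemma legendre_nat (n k : nat) : ~~ (k %| n)%N ->
  legendre n%:Z k = if [exists x : 'I_k, x ^ 2 == n %[mod k]] then 1 else -1.
Proof.
by move=> ndvd; rewrite /legendre quad_residue_nat (negPf ndvd) ifF //; apply/negbTE.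
Qed.

Lemma legendre_mod3 (n : nat) : ~~ (3 %| n)%N ->
  legendre n%:Z 3 = if (n %% 3 == 1)%N then 1 else -1.
Proof.
move=> ndvd; rewrite legendre_nat //; congr (if _ then _ else _).
have := ltn_pmod n (isT : 0 < 3)%N; move: ndvd; rewrite /dvdn.
move: (n %% 3)%N => [|[|[|r]]] //= _ _.
  by apply/existsP; exists 1.
by apply/existsP => -[[[|[|[|x]]]]].
Qed.

Lemma legendre_mod5 (n : nat) : ~~ (5 %| n)%N ->
  legendre n%:Z 5 = if (n %% 5 == 1)%N || (n %% 5 == 4)%N then 1 else -1.
Proof.
move=> ndvd; rewrite legendre_nat //; congr (if _ then _ else _).
have := ltn_pmod n (isT : 0 < 5)%N; move: ndvd; rewrite /dvdn.
move: (n %% 5)%N => [|[|[|[|[|r]]]]] //= _ _.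
- by apply/existsP; exists 1.
- by apply/existsP => -[[[|[|[|[|[|x]]]]]]].
- by apply/existsP => -[[[|[|[|[|[|x]]]]]]].
- by apply/existsP; exists (Ordinal (isT : 2 < 5)%N).
Qed.

(** * Euler's criterion *)

Lemma Fp_intr_eq (p : nat) (a b : int) : prime p ->
  (a%:~R == b%:~R :> 'F_p) = (a == b %[mod p%:Z])%Z.
Proof.
move=> p_prime; rewrite eqz_mod_dvd -subr_eq0 -rmorphB /=.
by rewrite -(dvdz_pcharf (pchar_Fp p_prime)).
Qed.

Lemma quad_residue_half_power (p : nat) (a : int) : prime p -> odd p ->
  quad_residue p a -> (a%:~R : 'F_p) ^+ (p.-1)./2 = 1.
Proof.
move=> p_prime p_odd /andP[ndvd /existsP[x]].
rewrite -Fp_intr_eq // rmorphXn /= => /eqP x2.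
rewrite -x2 -exprM mul2n even_halfK; last by case: p p_odd {a ndvd x x2 p_prime}.
apply: Fp_fermat => //; apply: contra ndvd => /eqP x0.
by rewrite (dvdz_pcharf (pchar_Fp p_prime)) -x2 x0 expr0n.
Qed.

(** The list [alpha] yields the converse half of Euler's criterion: its (p-1)/2 classes already
    exhaust the roots of X^((p-1)/2) - 1. *)
Lemma legendre_half_power (p : nat) (alpha : 'I_(p.-1)./2 -> int) (a : int) :
  prime p -> odd p -> represents_quad_residues alpha ->
  (legendre a p)%:~R = (a%:~R : 'F_p) ^+ (p.-1)./2.
Proof.
move=> p_prime p_odd [alpha_inj alphaP]; have p_gt1 := prime_gt1 p_prime.
have half_gt0 : (0 < (p.-1)./2)%N by lia.
rewrite /legendre (dvdz_pcharf (pchar_Fp p_prime)).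
case: eqP => [->|/eqP a_neq0]; first by rewrite expr0n eqn0Ngt half_gt0.
case: ifP => [/quad_residue_half_power-> //|not_res].
have : ((a%:~R : 'F_p) ^+ (p.-1)./2) ^+ 2 == 1.
  by rewrite -exprM muln2 even_halfK ?Fp_fermat //; lia.
rewrite sqrf_eq1 => /orP[|/eqP->]; last by rewrite rmorphN1.
move/eqP=> a_pow; case/negP: not_res; apply/alphaP.
pose a_ i : 'F_p := (alpha i)%:~R.
have [||i /esym/eqP] := @unity_root_enum _ _ a_ _ half_gt0 _ _ a_pow.
- by move=> i j /eqP; rewrite Fp_intr_eq // => /eqP/alpha_inj.
- by move=> i; apply: quad_residue_half_power => //; apply/alphaP; exists i.
by rewrite Fp_intr_eq // => /eqP; exists i.
Qed.

Lemma legendre_cases (a : int) (p : nat) : legendre a p \in [:: 0; 1; -1].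
Proof. by rewrite /legendre; do 2?case: ifP. Qed.

(** Two such values differ by at most 2 < p, so identities between symbols may be checked modulo
    p. *)
Lemma Fp_sign_inj (p : nat) : prime p -> (2 < p)%N ->
  {in [:: 0; 1; -1] &, injective (fun x : int => x%:~R : 'F_p)}.
Proof.
move=> p_prime p_gt2 x y; rewrite !inE => xP yP /eqP.
rewrite Fp_intr_eq // eqz_mod_dvd => dvd_xy.
apply/eqP; rewrite -subr_eq0 -absz_eq0; apply/negPn/negP => xy_neq0.
have /dvdn_leq : (p %| `|x - y|)%N by [].
rewrite lt0n xy_neq0 => /(_ isT); apply/negP; rewrite -ltnNge.
apply: leq_ltn_trans p_gt2.
by case/or3P: xP => /eqP->; case/or3P: yP => /eqP->.
Qed.

(** By Euler's criterion the left side is the product of the symbols of 1, ..., q, and r <= q means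
    4r < p. *)
Lemma fact_half_power (p q : nat) (alpha : 'I_(p.-1)./2 -> int) :
  prime p -> p = (4 * q).+1 -> represents_quad_residues alpha ->
  q`!%:R ^+ (2 * q) =
  (-1) ^+ #|[set r : 'I_p | [&& (0 < r)%N, (4 * r < p)%N &
                                legendre r%:Z p == -1]]| :> 'F_p.
Proof.
move=> p_prime def_p alphaP; have half_p : (p.-1)./2 = (2 * q)%N by lia.
have p_odd : odd p by lia.
pose F r : 'F_p := (legendre r%:Z p)%:~R.
have FE r : F r = r%:R ^+ (2 * q).
  by rewrite /F (legendre_half_power _ _ _ p_prime p_odd alphaP) half_p.
rewrite fact_prod natr_prod -prodrXl.
under eq_bigr => r _ do rewrite -FE.
rewrite (@big_nat_widen _ _ _ 1 q.+1 p) /=; last by lia.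
rewrite big_geq_mkord.
transitivity (\prod_(r < p | (0 < r)%N && (4 * r < p)%N)
                 (if legendre r%:Z p == -1 then -1 else 1 : 'F_p)).
  apply: eq_big => r; first by rewrite andbC; congr (_ && _); lia.
  rewrite ltnS => /andP[le_rq r_gt0]; rewrite /F.
  have : F r != 0.
    by rewrite FE expf_neq0 ?Fp_natr_neq0 // r_gt0 ltn_ord.
  rewrite /F; have := legendre_cases r%:Z p; rewrite !inE.
  by case/or3P=> /eqP ->; rewrite ?eqxx ?rmorphN1.
rewrite -big_mkcondr prodr_const; congr (_ ^+ _); apply: eq_card => r.
by rewrite !inE unfold_in -andbA.
Qed.

(** * The determinant modulo p and the theorem *)

Lemma Fp_S2_power (p q : nat) (alpha : 'I_(p.-1)./2 -> int) :
  prime p -> p = (4 * q).+1 -> represents_quad_residues alpha ->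
  ((S2 alpha (3 + (p.-1)./2) (-1))%:~R : 'F_p) ^+ q =
  (if odd q then 3 else 5)%N%:R ^+ (2 * q) * q`!%:R ^+ (2 * q).
Proof.
move=> p_prime def_p alphaP; have half_p : (p.-1)./2 = (2 * q)%N by lia.
have p_odd : odd p by lia.
pose a i : 'F_p := (alpha i)%:~R.
have a_inj : injective a.
  by move=> i j /eqP; rewrite Fp_intr_eq // => /eqP/alphaP.1.
have aX i : a i ^+ (p.-1)./2 = 1.
  by apply: quad_residue_half_power => //; apply/alphaP.2; exists i.
rewrite /S2 -det_map_mx.
have -> : map_mx intr (\matrix_(i, j) (alpha i + -1 * alpha j) ^+ (3 + (p.-1)./2)) =
          \matrix_(i, j) (a i - a j) ^+ (3 + (p.-1)./2) :> 'M['F_p]__.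
  by apply/matrixP=> i j; rewrite !mxE rmorphXn rmorphD rmorphM rmorphN1 mulN1r.
move: (p.-1)./2 half_p {alpha alphaP} a a_inj aX => m -> a a_inj aX.
exact: Fp_det_power_half.
Qed.

Theorem corollary1p12 (p : nat) (alpha : 'I_(p.-1)./2 -> int)
    (p_prime : prime p) (p_mod4 : (p = 1 %[mod 4])%N)
    (alphaP : represents_quad_residues alpha) :
  (exists s : int, s ^+ 2 = S2 alpha (3 + (p.-1)./2)%N (-1)) /\
  (forall s : int, s ^+ 2 = S2 alpha (3 + (p.-1)./2)%N (-1) ->
     legendre s p =
       (-1) ^+ #|[set r : 'I_p | [&& (0 < r)%N, (4 * r < p)%N & legendre r%:Z p == -1]]|
       * legendre p%:Z `|4 + (-1) ^+ (p.-1 %/ 4) : int|%N).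
Proof.
have [q def_p] : exists q, p = (4 * q).+1 by exists (p %/ 4)%N; lia.
have p_gt1 := prime_gt1 p_prime; have p_odd : odd p by lia.
split.
  (* The exponent 3 + (p-1)/2 is odd because (p-1)/2 = 2q. *)
  apply: det_skew_int_sqr; apply/matrixP=> i j; rewrite !mxE !mulN1r.
  by rewrite -opprB exprNn -signr_odd oddD (_ : odd _./2 = false) ?mulN1r //; lia.
(* The q-th power of s^2 is s^(2q), the symbol of s by Euler's criterion. *)
move=> s /(congr1 (fun x => (x%:~R : 'F_p) ^+ q)).
rewrite (Fp_S2_power _ _ _ p_prime def_p alphaP) rmorphXn -exprM.
rewrite (fact_half_power _ _ _ p_prime def_p alphaP) => s_pow.
have -> : (p.-1 %/ 4 = q)%N by lia.
(* Reciprocity for 3 and 5: the Gauss sum evaluations match the tables of symbols of p modulo 3 and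
   5. *)
have legendreE : (legendre p%:Z `|4 + (-1) ^+ q : int|)%:~R =
                 (if odd q then 3 else 5)%N%:R ^+ (2 * q) :> 'F_p.
  rewrite -signr_odd; case: (boolP (odd q)) => q_odd /=.
    rewrite (Fp_three_half _ _ p_prime def_p) (legendre_mod3 p).
      by case: ifP; rewrite ?rmorphN1.
    by rewrite dvdn_prime2 //; lia.
  rewrite (Fp_five_half _ _ p_prime def_p); last by lia.
  rewrite (legendre_mod5 p); first by case: ifP; rewrite ?rmorphN1.
  by rewrite dvdn_prime2 //; lia.
apply: (Fp_sign_inj _ p_prime).
- by lia.
- exact: legendre_cases.
- rewrite -signr_odd; case: (odd _); rewrite ?expr1 ?expr0 ?mul1r ?legendre_cases //.
  have := legendre_cases p%:Z `|4 + (-1) ^+ q : int|; rewrite !inE.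
  by case/or3P=> /eqP->.
- rewrite (legendre_half_power _ _ _ p_prime p_odd alphaP) rmorphM rmorphXn /=.
  rewrite rmorphN1 legendreE mulrC -s_pow; congr (_ ^+ _); lia.
Qed.
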